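(* Let the central Delannoy numbers $D(n)$ be defined by $D(0)=1$, $D(1)=3$ and $D(n)=\frac{3(2n-1)}{n}D(n-1)-\frac{n-1}{n}D(n-2)$ for $n\geq 2$. The sequence $\{D(n)\}_{n\geq 0}$ is ratio log-concave.
   Context: A sequence $(x_n)_{n\ge m}$ of positive reals is log-concave if $x_n^2\ge x_{n-1}x_{n+1}$ for all $n\ge m+1$. A sequence $(a_n)_{n\ge m}$ of positive reals is ratio log-concave if $(a_{n+1}/a_n)_{n\ge m}$ is log-concave. *)

(* Defs.v *)
From HB Require Import structures.
From mathcomp Require Import all_boot all_order all_algebra.
From mathcomp Require Import reals.
Set Implicit Arguments.
Unset Strict Implicit.
Unset Printing Implicit Defensive.
Import Order.TTheory GRing.Theory Num.Theory.
Local Open Scope ring_scope.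

(* A sequence (x_n)_{n >= m} is encoded as a function on nat whose values below
   m are ignored; positivity of the terms is part of both notions. *)
Definition log_concave (R : realType) (m : nat) (x : nat -> R) : Prop :=
  (forall n : nat, (m <= n)%N -> 0 < x n) /\
  (forall n : nat, (m.+1 <= n)%N -> x n.-1 * x n.+1 <= x n ^+ 2).

Definition ratio_log_concave (R : realType) (m : nat) (a : nat -> R) : Prop :=
  (forall n : nat, (m <= n)%N -> 0 < a n) /\
  log_concave m (fun n => a n.+1 / a n).

Fixpoint central_delannoy (R : realType) (n : nat) : R :=
  match n with
  | 0%N => 1
  | 1%N => 3
  | ((k.+1) as p).+1 =>
      3 * (2 * n%:R - 1) / n%:R * central_delannoy R p
      - (n%:R - 1) / n%:R * central_delannoy R k
  end.

(* Main.v *)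
Require Import Defs.
From HB Require Import structures.
From mathcomp Require Import all_boot all_order all_algebra.
From mathcomp Require Import reals.
From mathcomp Require Import ring lra.
Set Implicit Arguments.
Unset Strict Implicit.
Unset Printing Implicit Defensive.
Import Order.TTheory GRing.Theory Num.Theory.
Local Open Scope ring_scope.

(** Let r_n = D(n+1)/D(n).  The recurrence expresses both r_{n-1} and r_{n+1}
    through r_n, so r_{n-1} r_{n+1} <= r_n^2 becomes a quartic inequality
    F_n(r_n) >= 0.  On [3, +oo) the quartic F_n is concave and F_n(3) > 0, hence
    it suffices to find u_n >= r_n with F_n(u_n) >= 0.  With s = sqrt 2,
    truncating the asymptotic expansion of r_n in powers of 1/(n+1) gives
      u_n = (3 + 2 s) (1 - 1/(2 (n+1))) - s / (32 (n+1)^2),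
    and r_n <= u_n propagates along the recurrence, which is increasing in
    r_{n-1}. *)

(** * Inequalities over an ordered field with a square root [s] of 2 *)

Section RatioBounds.
Variable R : realFieldType.
Implicit Types s x m r u p q : R.

Definition ratio_upper s x : R :=
  (3 + 2 * s) * (1 - (2 * (x + 1))^-1) - s / (32 * (x + 1) ^+ 2).

Definition ratio_quartic x r : R :=
  r ^+ 3 * (3 * (2 * x + 1) / (x + 1) - r)
  - x / (x + 1) * (3 * (2 * x + 3) / (x + 2)) * r
  + x / (x + 1) * ((x + 1) / (x + 2)).

(* The coefficients of 1 and of s = sqrt 2 in 2^18 m^8 (m + 1) F_n(u_n), where
   m = n + 1. *)
Definition certificate_rat m : R :=
  8192 * (336 * m ^+ 2 - 337 * m + 114) * m ^+ 4
  - 256 * 439 * m ^+ 3 - 6016 * m ^+ 2 - 129 * m - 1.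

Definition certificate_sqrt m : R :=
  2048 * (960 * m ^+ 2 - 963 * m + 321) * m ^+ 4
  - 32 * 2445 * m ^+ 3 - 4560 * m ^+ 2 - 48 * m.

(** For m >= 1 the terms of degree at most 3 are absorbed by the multiple of m^4 that the quadratic
    factor guarantees. *)
Lemma certificate_ge0 m : 1 <= m ->
  0 <= certificate_rat m /\ 0 <= certificate_sqrt m.
Proof.
move=> m1.
have m2 : m <= m ^+ 2 by rewrite ler_eXnr.
have m3 : m ^+ 2 <= m ^+ 3 by rewrite ler_weXn2l.
have m4 : m ^+ 3 <= m ^+ 4 by rewrite ler_weXn2l.
have m4_ge0 : 0 <= m ^+ 4 by rewrite exprn_ge0 //; lra.
(* 113 and 318 are the values at m = 1 of the two quadratics, both increasing for m >= 1. *)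
have a1 : 113 <= 336 * m ^+ 2 - 337 * m + 114 by clear m3 m4 m4_ge0; nra.
have b1 : 318 <= 960 * m ^+ 2 - 963 * m + 321 by clear m3 m4 m4_ge0 a1; nra.
have := ler_wpM2r m4_ge0 a1; have := ler_wpM2r m4_ge0 b1.
rewrite /certificate_rat /certificate_sqrt -![_ * _ * m ^+ 4]mulrA.
move: (_ * m ^+ 4) (_ * m ^+ 4) => p q.
move: (m ^+ 2) (m ^+ 3) (m ^+ 4) m2 m3 m4 m4_ge0 {a1 b1} => *; split; lra.
Qed.

Lemma ratio_quartic_upper_ge0 s x :
  0 < s -> s ^+ 2 = 2 -> 0 <= x -> 0 <= ratio_quartic x (ratio_upper s x).
Proof.
move=> s0 s2 x0.
have x1 : 0 < x + 1 by lra.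
have x2 : 0 < x + 2 by lra.
have [|A0 B0] := @certificate_ge0 (x + 1); first by lra.
have c0 : 0 < 2 ^+ 18 * (x + 1) ^+ 8 * (x + 2) by rewrite !mulr_gt0 ?exprn_gt0.
rewrite -(pmulr_rge0 _ c0).
suff -> : 2 ^+ 18 * (x + 1) ^+ 8 * (x + 2) * ratio_quartic x (ratio_upper s x)
    = certificate_rat (x + 1) + s * certificate_sqrt (x + 1).
  by rewrite addr_ge0 // mulr_ge0 // ltW.
rewrite /ratio_quartic /ratio_upper /certificate_rat /certificate_sqrt.
by field: s2; rewrite !lt0r_neq0.
Qed.

Lemma sqrt2_ge s : 0 < s -> s ^+ 2 = 2 -> 7 / 5 <= s.
Proof. by rewrite expr2 => s0 s2; nra. Qed.

(** Makes division by [ratio_upper] legitimate in the induction step. The main term alone is at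
    least 3/4 (3 + 2 s) > 4, and the correction is tiny. *)
Lemma ratio_upper_ge3 s x :
  0 < s -> s ^+ 2 = 2 -> 1 <= x -> 3 <= ratio_upper s x.
Proof.
move=> s0 s2 x1; have sge := sqrt2_ge s0 s2.
have sle : s <= 3 / 2 by move: s2; rewrite expr2; nra.
have i0 : 0 < (x + 1)^-1 by rewrite invr_gt0; lra.
have i1 : (x + 1)^-1 <= 2^-1 by rewrite lef_pV2 ?posrE; lra.
rewrite /ratio_upper !invfM; nra.
Qed.

(* After clearing denominators the difference of the two sides is linear in x. *)
Lemma ratio_upper_step s x : 0 < s -> s ^+ 2 = 2 -> 1 <= x ->
  3 * (2 * x + 3) / (x + 2) - (x + 1) / (x + 2) / ratio_upper s x
  <= ratio_upper s (x + 1).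
Proof.
move=> s0 s2 x1; have u3 := ratio_upper_ge3 s0 s2 x1.
have xx1 : x + 1 != 0 by apply: lt0r_neq0; lra.
have xx2 : x + 2 != 0 by apply: lt0r_neq0; lra.
have u0 : ratio_upper s x != 0 by apply: lt0r_neq0; lra.
pose c : R := 1024 * (x + 1) ^+ 2 * (x + 2) ^+ 2 * ratio_upper s x.
have c0 : 0 < c by rewrite /c !mulr_gt0 ?exprn_gt0 //; lra.
rewrite -subr_ge0 -(pmulr_rge0 _ c0).
suff -> : c * (ratio_upper s (x + 1)
    - (3 * (2 * x + 3) / (x + 2) - (x + 1) / (x + 2) / ratio_upper s x))
    = (66 + 240 * s) + (128 + 192 * s) * x.
  by rewrite addr_ge0 ?mulr_ge0 //; lra.
(* The inverse of [ratio_upper s x] is cleared while [ratio_upper] is still folded; once it is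
   unfolded, only x + 1 and x + 2 remain as denominators. *)
have -> : c * (ratio_upper s (x + 1)
    - (3 * (2 * x + 3) / (x + 2) - (x + 1) / (x + 2) / ratio_upper s x)) =
    1024 * (x + 1) ^+ 2 * (x + 2) * ((x + 2) * ratio_upper s (x + 1) * ratio_upper s x
     - 3 * (2 * x + 3) * ratio_upper s x + (x + 1)).
  by rewrite /c; field; rewrite u0 xx2.
have x2E : x + 1 + 1 = x + 2 by ring.
by rewrite /ratio_upper x2E; field: s2; rewrite xx1 xx2.
Qed.

(* The second divided difference of the quartic at 3, r, u is nonpositive. *)
Lemma ratio_quartic_ge0 x r u : 0 <= x -> 3 <= r <= u ->
  0 <= ratio_quartic x u -> 0 <= ratio_quartic x r.
Proof.
move=> x0 /andP[r3 ru].
rewrite /ratio_quartic.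
have i1 : 0 < (x + 1)^-1 by rewrite invr_gt0; lra.
have i2 : 0 < (x + 2)^-1 by rewrite invr_gt0; lra.
have aE : 3 * (2 * x + 1) / (x + 1) = 3 + 3 * (x / (x + 1)).
  by field; apply: lt0r_neq0; lra.
have a'E : 3 * (2 * x + 3) / (x + 2) = 6 - 3 / (x + 2).
  by field; apply: lt0r_neq0; lra.
have b1 : x / (x + 1) <= 1 by rewrite ler_pdivrMr; lra.
have b0 : 0 <= x / (x + 1) by rewrite mulr_ge0 // ltW.
have b'0 : 0 <= (x + 1) / (x + 2) by rewrite mulr_ge0 //; lra.
rewrite aE a'E.
move: (x / (x + 1)) b0 b1 => b b0 b1.
move: ((x + 1) / (x + 2)) b'0 => b' b'0.
have a'6 : 6 - 3 / (x + 2) <= 6 by lra.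
move: (6 - 3 / (x + 2)) a'6 => a' a'6.
pose f y := y ^+ 3 * (3 + 3 * b - y) - b * a' * y + b * b'.
rewrite -/(f u) -/(f r) => fu0.
have f3 : 0 <= f 3.
  have -> : f 3 = b * (81 - 3 * a' + b') by rewrite /f; ring.
  by rewrite mulr_ge0 //; lra.
have [u3|u3] := eqVneq u 3.
  by have -> : r = 3 by apply/eqP; rewrite eq_le; lra.
have u3' : 0 < u - 3 by rewrite subr_gt0 lt_neqAle eq_sym u3 (le_trans r3).
rewrite -(pmulr_rge0 _ u3').
have -> : (u - 3) * f r = (u - r) * f 3 + (r - 3) * f u
   + (r - 3) * (u - r) * (u - 3) *
     (9 + r ^+ 2 + u ^+ 2 + 3 * r + 3 * u + r * u - (3 + 3 * b) * (3 + r + u)).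
  by rewrite /f; ring.
(* The extremal case is b = 1, r = u = 3, where the expression vanishes. *)
have g0 : 0 <= 9 + r ^+ 2 + u ^+ 2 + 3 * r + 3 * u + r * u
               - (3 + 3 * b) * (3 + r + u).
  by nra.
by rewrite !addr_ge0 ?mulr_ge0 //; lra.
Qed.

(** Here p, r, q stand for r_{n-1}, r_n, r_{n+1} with x = n. The two recurrences factor the quartic
    as r^2 - p q times the positive number r x / ((x + 1) p). *)
Lemma ratio_quartic_sqr x p r q : 0 < x -> 0 < p -> 0 < r ->
  (x + 1) * (r * p) = 3 * (2 * x + 1) * p - x ->
  (x + 2) * (q * r) = 3 * (2 * x + 3) * r - (x + 1) ->
  0 <= ratio_quartic x r -> p * q <= r ^+ 2.
Proof.
move=> x0 p0 r0 pE qE.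
have x1 : x + 1 != 0 by apply: lt0r_neq0; lra.
have x2 : x + 2 != 0 by apply: lt0r_neq0; lra.
have aE : 3 * (2 * x + 1) / (x + 1) - r = x / (x + 1) / p.
  apply: (mulIf x1); apply: (mulIf (lt0r_neq0 p0)).
  by rewrite mulrBl mulrBl -[r * _ * _]mulrA [(x + 1) * p]mulrC mulrA
             [r * p * _]mulrC pE; field; rewrite x1 lt0r_neq0.
have -> : ratio_quartic x r = r * (x / (x + 1) / p) * (r ^+ 2 - p * q).
  have -> : r * (x / (x + 1) / p) * (r ^+ 2 - p * q) =
      r ^+ 3 * (x / (x + 1) / p) - x / (x + 1) / (x + 2) * ((x + 2) * (q * r)).
    by field; rewrite x1 x2 lt0r_neq0.
  by rewrite /ratio_quartic aE qE; field; rewrite x1 x2 lt0r_neq0.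
rewrite pmulr_rge0 ?subr_ge0 //.
by rewrite !mulr_gt0 ?invr_gt0 //; lra.
Qed.

End RatioBounds.

(** * Growth and consecutive ratios of the Delannoy numbers *)

Lemma central_delannoyS (R : realType) (n : nat) :
  (n%:R + 2) * central_delannoy R n.+2 =
  3 * (2 * n%:R + 3) * central_delannoy R n.+1
  - (n%:R + 1) * central_delannoy R n.
Proof.
have n2 : n%:R + 2 != 0 :> R by rewrite -natrD pnatr_eq0 addn2.
have -> : central_delannoy R n.+2 =
  3 * (2 * n.+2%:R - 1) / n.+2%:R * central_delannoy R n.+1
  - (n.+2%:R - 1) / n.+2%:R * central_delannoy R n by [].
have -> : n.+2%:R = n%:R + 2 :> R by rewrite -addn2 natrD.
by field.
Qed.

(** By the recurrence, (n + 2) (D(n+2) - 3 D(n+1)) = (n + 1) (3 D(n+1) - D(n)), which the induction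
    hypothesis makes nonnegative. *)
Lemma central_delannoy_growth (R : realType) (n : nat) :
  0 < central_delannoy R n
  /\ 3 * central_delannoy R n <= central_delannoy R n.+1.
Proof.
elim: n => [|n [Dn DSn]]; first by rewrite /=; split; lra.
have n0 : 0 <= n%:R :> R by [].
have DSn0 : 0 < central_delannoy R n.+1 by lra.
split=> //; have := central_delannoyS R n.
move: (central_delannoy R n.+2) => D2 D2E.
have n2 : 0 < n%:R + 2 :> R by lra.
rewrite -(ler_pM2l n2) D2E.
have : 0 <= n%:R * (central_delannoy R n.+1 - 3 * central_delannoy R n).
  by rewrite mulr_ge0 ?subr_ge0.
have : 0 <= n%:R * central_delannoy R n by rewrite mulr_ge0 // ltW.
by lra.
Qed.

Lemma central_delannoy_gt0 (R : realType) (n : nat) : 0 < central_delannoy R n.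
Proof. by case: (central_delannoy_growth R n). Qed.

Definition delannoy_ratio (R : realType) (n : nat) : R :=
  central_delannoy R n.+1 / central_delannoy R n.

Lemma delannoy_ratio_ge3 (R : realType) (n : nat) : 3 <= delannoy_ratio R n.
Proof.
by have [D0 D3] := central_delannoy_growth R n; rewrite ler_pdivlMr.
Qed.

Lemma delannoy_ratioS (R : realType) (n : nat) :
  (n%:R + 2) * (delannoy_ratio R n.+1 * delannoy_ratio R n) =
  3 * (2 * n%:R + 3) * delannoy_ratio R n - (n%:R + 1).
Proof.
have D0 := lt0r_neq0 (central_delannoy_gt0 R n).
have D1 := lt0r_neq0 (central_delannoy_gt0 R n.+1).
have -> : delannoy_ratio R n.+1 * delannoy_ratio R n =
    central_delannoy R n.+2 / central_delannoy R n.
  by rewrite /delannoy_ratio mulrA divfK.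
rewrite [LHS]mulrA central_delannoyS /delannoy_ratio.
by field.
Qed.

(** The bound starts at index 1 because it fails at 0: [ratio_upper s 0] is about 2.87, while r_0 =
    3. *)
Lemma delannoy_ratio_le_upper (R : realType) (s : R) (n : nat) :
  0 < s -> s ^+ 2 = 2 -> delannoy_ratio R n.+1 <= ratio_upper s n.+1%:R.
Proof.
move=> s0 s2; elim: n => [|n IHn].
  (* The base case 13/3 <= (288 + 191 s) / 128 amounts to s >= 800/573 = 1.396..., so s >= 7/5
     suffices. *)
  have sge := sqrt2_ge s0 s2.
  have -> : delannoy_ratio R 1 = 13 / 3 by rewrite /delannoy_ratio /=; field.
  have -> : ratio_upper s 1 = (288 + 191 * s) / 128.
    by rewrite /ratio_upper; field: s2.
  by lra.
have x1 : 1 <= n.+1%:R :> R by rewrite ler1n.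
rewrite -[n.+2%:R]natr1; apply: le_trans (ratio_upper_step s0 s2 x1).
have rE := delannoy_ratioS R n.+1.
have r3 := delannoy_ratio_ge3 R n.+1.
move: (n.+1%:R) x1 IHn rE => x x1 IHn rE.
move: (delannoy_ratio R n.+1) (delannoy_ratio R n.+2) r3 IHn rE => r q r3 ru rE.
have r0 : 0 < r by lra.
have x2 : 0 < x + 2 by lra.
have -> : q = 3 * (2 * x + 3) / (x + 2) - (x + 1) / (x + 2) / r.
  apply: (mulIf (lt0r_neq0 r0)); apply: (mulfI (lt0r_neq0 x2)); rewrite rE.
  by field; rewrite !lt0r_neq0.
rewrite lerD2l lerN2; apply: ler_wpM2l; last by rewrite lef_pV2 ?posrE //; lra.
by rewrite divr_ge0 //; lra.
Qed.

Theorem theorem4p7 (R : realType) :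
  ratio_log_concave 0 (central_delannoy R).
Proof.
split=> [n _|]; first exact: central_delannoy_gt0.
split=> [n _|[//|n] _].
  by rewrite divr_gt0 // central_delannoy_gt0.
rewrite -/(delannoy_ratio R n) -/(delannoy_ratio R n.+1) -/(delannoy_ratio R n.+2).
have s0 : 0 < Num.sqrt 2 :> R by rewrite sqrtr_gt0.
have s2 : Num.sqrt 2 ^+ 2 = 2 :> R by rewrite sqr_sqrtr.
have r0 k : 0 < delannoy_ratio R k.
  by apply: lt_le_trans (delannoy_ratio_ge3 R k).
have x0 : 0 < n.+1%:R :> R by rewrite ltr0n.
(* The middle ratio is r_{n+1}, so x = n + 1 >= 1 lies in the range of the upper bound. *)
apply: (ratio_quartic_sqr x0) => //.
- rewrite -[n.+1%:R]natr1 -addrA -[1 + 1]/(2 : R) delannoy_ratioS.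
  by ring.
- exact: delannoy_ratioS.
- apply: (@ratio_quartic_ge0 _ _ _ (ratio_upper (Num.sqrt 2) n.+1%:R)).
  + exact: ltW.
  + by rewrite delannoy_ratio_ge3 delannoy_ratio_le_upper.
  + by rewrite ratio_quartic_upper_ge0 // ltW.
Qed.
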